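(* Let $p$ be a prime and let $r,t\ge1$ be integers. Then the sets $\Gamma_1$ and $\Gamma_2$ (defined in the context from the data $h,m,H_i,x_{j,i}$) can be chosen, i.e. there exist admissible data $h$, $m$, $H_1,\dots,H_n$, $x_{j,i}$, such that $$|\Gamma_1|\le 16pt^2r^2,\qquad |\Gamma_2|\le 16pt^2r^3(2+\log_2(p)).$$
   Context: Let $K:=\{0\}\cup\{2^i:0\le i\le k,\ i\in\mathbb{Z}\}\subseteq\mathbb{F}_p$ (integers identified with their images in $\mathbb{F}_p$), where $k\in\mathbb{Z}$ is minimal such that $2^k\ge p/3$. Subspaces $H_1,\dots,H_n$ of $\mathbb{F}_p^r$ are called $m$-generating if $\mathrm{span}_{\mathbb{F}_p}\{H_{i_1},\dots,H_{i_m}\}=\mathbb{F}_p^r$ for all $1\le i_1<\dots<i_m\le n$. Admissible data: an integer $m\ge1$, with $n:=4t(m-1)+1$; an integer $h$ with $1\le h\le r$; $m$-generating subspaces $H_1,\dots,H_n\le\mathbb{F}_p^r$, all of dimension $h$; and, for each $1\le i\le n$, vectors $x_{1,i},\dots,x_{r-h,i}\in\mathbb{F}_p^r$ with $\mathrm{span}_{\mathbb{F}_p}\{H_i,x_{1,i},\dots,x_{r-h,i}\}=\mathbb{F}_p^r$. For such data define $$\Gamma_1:=\bigcup_{i}H_i,\qquad \Gamma_2:=\bigcup_i\bigl(H_i+\{kx_{i,j}':k\in K,\ 1\le j\le r-h\}\bigr),$$ where $x_{i,j}':=x_{j,i}$ and $A+B:=\{a+b:a\in A,\ b\in B\}$.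 *)

(* Defs.v *)
From HB Require Import structures.
From mathcomp Require Import all_boot all_order all_algebra.

Set Implicit Arguments.
Unset Strict Implicit.
Unset Printing Implicit Defensive.

Import Order.TTheory GRing.Theory Num.Theory.

Local Open Scope ring_scope.

Definition is_min_exponent (p : nat) (k : int) : Prop :=
  (p%:R / 3 <= 2 ^ k :> rat) /\
  (forall k' : int, (p%:R / 3 <= 2 ^ k' :> rat) -> k <= k').

Lemma is_min_exponent_exists (p : nat) :
  prime p -> exists k : int, is_min_exponent p k.
Proof.
move=> /prime_gt1 p_gt1.
have h3 (i : nat) : (p%:R / 3 <= 2 ^ i%:Z :> rat) = (p <= 2 ^ i * 3)%N.
  by rewrite ler_pdivrMr // -exprnP -natrX -natrM ler_nat.
have exk : exists i, (p <= 2 ^ i * 3)%N.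
  by exists p; apply: leq_trans (ltnW (ltn_expl p _)) (leq_pmulr _ _).
case: (ex_minnP exk) => k kP kmin.
exists k%:Z; split=> [|[i|i]]; first by rewrite h3.
  by rewrite h3 => /kmin.
rewrite NegzE -exprnN ler_pdivrMr // mulrC.
rewrite ler_pdivlMr ?exprn_gt0 // -natrX -natrM ler_nat leqNgt.
case/negP; apply: leq_trans (leq_mul p_gt1 (leq_pexp2l _ (ltn0Sn i))) => //.
Qed.

(* {0} together with the images in F_p of the 2^i, 0 <= i <= k *)
Definition Kset (p : nat) (k : int) : {set 'F_p} :=
  0 |: [set (2 ^ (i : nat))%N%:R | i : 'I_(`|k|.+1) & (i : nat)%:Z <= k].

Definition m_generating (F : fieldType) (r n m : nat)
    (H : 'I_n -> {vspace 'rV[F]_r}) : Prop :=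
  forall I : {set 'I_n}, #|I| = m -> (\sum_(i in I) H i)%VS = fullv.

(* [x i j] is the vector written x_{j,i}, or x'_{i,j} *)
Record admissible (p r t m h : nat)
    (H : 'I_(4 * t * (m - 1) + 1) -> {vspace 'rV['F_p]_r})
    (x : 'I_(4 * t * (m - 1) + 1) -> 'I_(r - h) -> 'rV['F_p]_r) : Prop :=
  Admissible {
    adm_m : (1 <= m)%N;
    adm_h : (1 <= h <= r)%N;
    adm_dim : forall i, \dim (H i) = h;
    adm_gen : m_generating m H;
    adm_span : forall i,
      (H i + <<[seq x i j | j <- enum 'I_(r - h)]>>)%VS = fullv
  }.

Definition sumset (V : finZmodType) (A B : {set V}) : {set V} :=
  [set a + b | a in A, b in B].

Definition Gamma1 (p r n : nat) (H : 'I_n -> {vspace 'rV['F_p]_r}) :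
    {set 'rV['F_p]_r} :=
  \bigcup_(i < n) [set v in H i].

Definition Gamma2 (p r n d : nat) (k : int) (H : 'I_n -> {vspace 'rV['F_p]_r})
    (x : 'I_n -> 'I_d -> 'rV['F_p]_r) : {set 'rV['F_p]_r} :=
  \bigcup_(i < n)
    sumset [set v in H i] [set a *: x i j | a in Kset p k, j in [set: 'I_d]].

(* Main.v *)
Require Import Defs.
From HB Require Import structures.
From mathcomp Require Import all_boot all_order all_algebra.
From mathcomp Require Import all_field.
From mathcomp Require Import zify.
From mathcomp Require Import reals exp.

Set Implicit Arguments.
Unset Strict Implicit.
Unset Printing Implicit Defensive.

Import Order.TTheory GRing.Theory Num.Theory.

Local Open Scope ring_scope.

(** Let l be the least integer with 4tr <= p^l, and take m = r, h = min(l, r),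
    so that n = 4t(r-1)+1 <= 4tr <= p^l and, by minimality, p^l <= 4trp.
    Hence |Gamma_1| <= n p^h <= 4tr * 4trp, and since each H_i contributes to
    Gamma_2 at most p^h * |K| * (r - h) vectors, with |K| <= k + 2 and
    2^k <= p, the bound on Gamma_2 follows too.

    It remains to find n subspaces of dimension h any r of which span. Read a
    vector u of F_p^r as a polynomial P_u over F_p of degree less than r. For a
    in L = F_(p^l), the coordinates over F_p of the powers 1, a, ..., a^(r-1)
    form an r x l matrix; let [evalspace a] be the span of its columns, of
    dimension at most l. A vector u is orthogonal to it exactly when
    P_u(a) = 0. If r such spaces, for distinct points a, lay in a proper
    subspace, some nonzero u would be orthogonal to all of them, and the nonzero
    polynomial P_u of degree less than r would have r roots in L
    ([evalspace_generating]). As L has p^l >= n points there are enough of these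
    spaces, and enlarging each one to dimension exactly h keeps the property
    ([exists_generating_spaces]). *)

(** * Subspaces and orthogonality *)

Lemma dim_rV (F : fieldType) (r : nat) : \dim {:'rV[F]_r} = r.
Proof. by rewrite dimvf /dim /= mul1n. Qed.

Lemma exists_superspace_dim (F : fieldType) (vT : vectType F)
    (U : {vspace vT}) (h : nat) :
  (\dim U <= h <= \dim {:vT})%N ->
  exists2 V : {vspace vT}, (U <= V)%VS & \dim V = h.
Proof.
move=> /andP[Uh hT]; pose b := vbasis (U^C)%VS.
have bfree : free b := basis_free (vbasisP _).
pose W := <<take (h - \dim U) b>>%VS.
have dW : \dim W = (h - \dim U)%N.
  have /eqP-> : free (take (h - \dim U) b).
    by move: bfree; rewrite -{1}(cat_take_drop (h - \dim U) b) => /catl_free.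
  by rewrite size_takel // size_tuple dimv_compl leq_sub2r.
exists (U + W)%VS; first exact: addvSl.
rewrite dimv_disjoint_sum ?dW ?subnKC //.
apply/eqP; rewrite -subv0 -(capv_compl U) capvS //.
by apply/span_subvP => v /mem_take /vbasis_mem.
Qed.

(** The equations saying that u is orthogonal to a basis of U form a
    homogeneous linear system with fewer equations than unknowns. *)
Lemma exists_orthogonal (F : fieldType) (r : nat) (U : {vspace 'rV[F]_r}) :
  U != fullv ->
  exists2 u : 'rV[F]_r, u != 0 & forall v, v \in U -> v *m u^T = 0.
Proof.
move=> Uproper.
pose A : 'M[F]_(\dim U, r) := \matrix_i (vbasis U)`_i.
have ltUr : (\dim U < r)%N.
  move: Uproper; rewrite eqEdim subvf -ltnNge /= => ltU.
  exact: leq_trans ltU (eq_leq (dim_rV F r)).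
have : kermx A^T != 0.
  rewrite kermx_eq0 -row_leq_rank -ltnNge.
  exact: leq_ltn_trans (rank_leq_col _) ltUr.
case/rowV0Pn=> u /sub_kermxP uA u0; exists u => // v /coord_vbasis->.
rewrite mulmx_suml big1 // => i _; rewrite -scalemxAl.
suff -> : (vbasis U)`_i *m u^T = 0 by rewrite scaler0.
have -> : (vbasis U)`_i = row i A by rewrite rowK.
by rewrite -row_mul -[A *m _]trmxK trmx_mul trmxK uA trmx0 row0.
Qed.

Lemma exists_complement_basis (F : fieldType) (vT : vectType F) (d : nat)
    (U : {vspace vT}) : \dim U + d = \dim {:vT} ->
  exists x : 'I_d -> vT, (U + <<[seq x j | j <- enum 'I_d]>>)%VS = fullv.
Proof.
move=> dimU; pose b := vbasis (U^C)%VS.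
exists (fun j => b`_j).
have -> : [seq b`_(nat_of_ord j) | j <- enum 'I_d] = b.
  have sb : size b = d by rewrite size_tuple dimv_compl -dimU addKn.
  by rewrite -[RHS](mkseq_nth 0) sb /mkseq -val_enum_ord -map_comp.
by rewrite (span_basis (vbasisP _)) addv_complf.
Qed.

(** * Spaces orthogonal to the polynomials vanishing at a point *)

Section EvaluationSpaces.

Variables (F : fieldType) (L : fieldExtType F) (r : nat).

(** The span of the l columns of the r x l matrix whose row c lists the
    coordinates of a^c over F. *)
Definition evalspace (a : L) : {vspace 'rV[F]_r} :=
  <<[seq \row_(c < r) coord (vbasis {:L}) i (a ^+ c) | i : 'I_(\dim {:L})]>>%VS.

Lemma dim_evalspace a : (\dim (evalspace a) <= \dim {:L})%N.
Proof.
by apply: leq_trans (dim_span _) _; rewrite size_map -cardT card_ord.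
Qed.

(** Orthogonality to the i-th spanning vector says that the i-th coordinate of
    P_u(a), the sum of the u_c a^c, vanishes. *)
Lemma evalspace_orthogonal a (u : 'rV[F]_r) :
  (forall v, v \in evalspace a -> v *m u^T = 0) ->
  root (map_poly (in_alg L) (rVpoly u)) a.
Proof.
move=> orth; apply/rootP.
rewrite (@horner_coef_wide _ r); last first.
  by rewrite size_map_poly size_poly.
under eq_bigr => c _ do rewrite coef_map coef_rVpoly_ord /= mulr_algl.
rewrite (coord_vbasis (memvf (\sum_(c < r) u 0 c *: a ^+ c))) big1 // => i _.
suff -> : coord (vbasis {:L}) i (\sum_(c < r) u 0 c *: a ^+ c) = 0.
  by rewrite scale0r.
have /orth/matrixP/(_ 0 0) :
    \row_(c < r) coord (vbasis {:L}) i (a ^+ c) \in evalspace a.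
  by apply/memv_span/map_f; rewrite mem_enum.
rewrite !mxE linear_sum /= => uE; rewrite -[RHS]uE.
by apply: eq_bigr => c _; rewrite linearZ !mxE mulrC.
Qed.

(** If the sum were proper, some nonzero u would be orthogonal to every one of these spaces, and its
    polynomial, nonzero of degree less than r, would have at least r roots. *)
Lemma evalspace_generating (T : finType) (a : T -> L) (I : {set T}) :
  injective a -> (r <= #|I|)%N -> (\sum_(i in I) evalspace (a i))%VS = fullv.
Proof.
move=> a_inj rI; apply/eqP; apply: contraT => /exists_orthogonal[u u0 orth].
pose P := map_poly (in_alg L) (rVpoly u).
have P0 : P != 0.
  rewrite map_poly_eq0; apply: contra_neq u0 => u0.
  by rewrite -(rVpolyK u) u0 linear0.
have rootsP : all (root P) [seq a i | i <- enum I].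
  apply/allP => _ /mapP[i + ->]; rewrite mem_enum => iI.
  apply: evalspace_orthogonal => v vi; apply: orth.
  by apply: subvP vi; apply: (sumv_sup i).
have := max_poly_roots P0 rootsP.
rewrite map_inj_uniq // enum_uniq size_map -cardE => /(_ isT).
by rewrite ltnNge size_map_poly (leq_trans (size_poly _ _)).
Qed.

End EvaluationSpaces.

(** The points of L are given as a family indexed by 'I_(p ^ l), which avoids
    putting a finite structure on the extension. *)
Lemma exists_finite_extension (p l : nat) : prime p -> (0 < l)%N ->
  exists (L : fieldExtType 'F_p) (a : 'I_(p ^ l) -> L),
    \dim {:L} = l /\ injective a.
Proof.
move=> p_prime l_gt0; have [E pE cardE] := pPrimePowerField p_prime l_gt0.
exists (pPrimeCharType pE), (fun i => enum_val (cast_ord (esym cardE) i)).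
split; first by rewrite pprimeChar_dimf /= cardE pfactorK.
exact: inj_comp enum_val_inj (@cast_ord_inj _ _ _).
Qed.

(** The evaluation spaces of n distinct points have dimensions at most both l
    and r, varying with the degrees of the points; enlarging them to the common
    dimension min(l, r) cannot shrink a sum. *)
Lemma exists_generating_spaces (p r n l : nat) :
  prime p -> (0 < l)%N -> (n <= p ^ l)%N ->
  exists H : 'I_n -> {vspace 'rV['F_p]_r},
    (forall i, \dim (H i) = minn l r) /\ m_generating r H.
Proof.
move=> p_prime l_gt0 nq.
have [L [a [dimL a_inj]]] := exists_finite_extension p_prime l_gt0.
pose b i := a (widen_ord nq i).
have b_inj : injective b by move=> i j /a_inj/(congr1 val) /= /val_inj.
have ex i : exists V : {vspace 'rV['F_p]_r},
    (evalspace r (b i) <= V)%VS && (\dim V == minn l r).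
  have [|V sV dV] := @exists_superspace_dim _ _ (evalspace r (b i)) (minn l r).
    rewrite dim_rV geq_minr andbT leq_min -{1}dimL dim_evalspace /=.
    exact: leq_trans (dimvS (subvf _)) (eq_leq (dim_rV _ r)).
  by exists V; rewrite sV dV eqxx.
exists (fun i => xchoose (ex i)); split=> [i|I cardI].
  by have /andP[_ /eqP] := xchooseP (ex i).
apply/eqP; rewrite eqEsubv subvf /=.
rewrite -(evalspace_generating b_inj (eq_leq (esym cardI))).
apply/subv_sumP => i iI; apply: (sumv_sup i) => //.
by have /andP[] := xchooseP (ex i).
Qed.

(** * Cardinality bounds *)

Lemma card_bigcup_leq (T : finType) (n c : nat) (A : 'I_n -> {set T}) :
  (forall i, #|A i| <= c)%N -> (#|\bigcup_i A i| <= n * c)%N.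
Proof.
move=> Ac; rewrite -[n in leqRHS]card_ord -sum_nat_const.
elim/big_rec2: _ => [|i s B _ le]; first by rewrite cards0.
by apply: leq_trans (leq_card_setU _ _).1 (leq_add _ _).
Qed.

Lemma card_image2_leq (S T V : finType) (f : S -> T -> V)
    (A : {set S}) (B : {set T}) :
  (#|[set f a b | a in A, b in B]| <= #|A| * #|B|)%N.
Proof. by rewrite curry_imset2X -cardsX leq_imset_card. Qed.

Lemma card_subspace (p r : nat) (U : {vspace 'rV['F_p]_r}) : prime p ->
  #|[set v in U]| = (p ^ \dim U)%N.
Proof. by move=> p_prime; rewrite cardsE card_vspace card_Fp. Qed.

Lemma card_Gamma1 (p r n h : nat) (H : 'I_n -> {vspace 'rV['F_p]_r}) :
  prime p -> (forall i, \dim (H i) = h) -> (#|Gamma1 H| <= n * p ^ h)%N.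
Proof.
by move=> p_prime dimH; apply: card_bigcup_leq => i; rewrite card_subspace ?dimH.
Qed.

Lemma card_Kset (p k : nat) : (#|Kset p k| <= k + 2)%N.
Proof.
rewrite /Kset cardsU1 addn2 -[k.+2]add1n.
apply: leq_add; first exact: leq_b1.
apply: leq_trans (leq_imset_card _ _) _.
by apply: leq_trans (max_card _) _; rewrite card_ord.
Qed.

Lemma card_Gamma2 (p r n d h k : nat) (H : 'I_n -> {vspace 'rV['F_p]_r})
    (x : 'I_n -> 'I_d -> 'rV['F_p]_r) :
  prime p -> (forall i, \dim (H i) = h) ->
  (#|Gamma2 k H x| <= n * (p ^ h * ((k + 2) * d)))%N.
Proof.
move=> p_prime dimH; apply: card_bigcup_leq => i.
apply: leq_trans (card_image2_leq _ _ _) _.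
rewrite card_subspace // dimH leq_mul2l; apply/orP; right.
apply: leq_trans (card_image2_leq _ _ _) _.
by rewrite cardsT card_ord leq_mul2r card_Kset orbT.
Qed.

(** A negative exponent is impossible because p / 3 > 1 / 2. For k > 0, the
    inequality 2^k > p would give 2^(k-1) > p / 2 >= p / 3, against
    minimality. *)
Lemma min_exponent_nat (p : nat) (k : int) : prime p -> is_min_exponent p k ->
  exists2 k' : nat, k = k' & (2 ^ k' <= p)%N.
Proof.
move=> p_prime [kp kmin]; have p_gt1 := prime_gt1 p_prime.
case: k kp kmin => [k|k] kp kmin; last first.
  move: kp; rewrite NegzE -exprnN ler_pdivrMr // mulrC.
  rewrite ler_pdivlMr ?exprn_gt0 // -natrX -natrM ler_nat.
  have := leq_mul p_gt1 (leq_pexp2l (isT : 0 < 2)%N (ltn0Sn k)).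
  by move=> /leq_trans h /h.
exists k => //; case: k kp kmin => [|k] kp kmin; first exact: ltnW.
rewrite leqNgt; apply/negP => pk.
have : (p%:R / 3 <= 2 ^ k%:Z :> rat).
  rewrite ler_pdivrMr // -exprnP -natrX -natrM ler_nat.
  apply: leq_trans (ltnW pk) _; rewrite expnSr leq_mul2l orbT //.
by move/kmin; rewrite lez_nat ltnn.
Qed.

Theorem mainTheorem3 (R : realType) (p r t : nat) (k : int)
    (p_prime : prime p) (r_ge1 : (1 <= r)%N) (t_ge1 : (1 <= t)%N)
    (k_min : is_min_exponent p k) :
  exists (m h : nat)
    (H : 'I_(4 * t * (m - 1) + 1) -> {vspace 'rV['F_p]_r})
    (x : 'I_(4 * t * (m - 1) + 1) -> 'I_(r - h) -> 'rV['F_p]_r),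
  [/\ admissible H x,
      (#|Gamma1 H| <= 16 * p * t ^ 2 * r ^ 2)%N &
      #|Gamma2 k H x|%:R
        <= 16 * p%:R * t%:R ^+ 2 * r%:R ^+ 3 * (2 + ln p%:R / ln 2) :> R].
Proof.
have p_gt1 := prime_gt1 p_prime; have p_gt0 := prime_gt0 p_prime.
have [k' -> kp] := min_exponent_nat p_prime k_min.
have N_gt1 : (1 < 4 * t * r)%N.
  by rewrite -[2%N]/(2 * 1)%N -mulnA leq_mul // muln_gt0 t_ge1.
have nN : (4 * t * (r - 1) + 1 <= 4 * t * r)%N.
  by rewrite -{2}(subnK r_ge1) mulnDr leq_add2l muln1 muln_gt0.
have /andP[] := up_log_bounds p_gt1 N_gt1; set l := up_log p _ => lN Nl.
have l_gt0 : (0 < l)%N by rewrite up_log_gt0 p_gt1.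
have nq := leq_trans nN Nl.
have [H [dimH genH]] := exists_generating_spaces r p_prime l_gt0 nq.
have dimHr i : (\dim (H i) + (r - minn l r))%N = \dim {:'rV['F_p]_r}.
  by rewrite dimH subnKC ?geq_minr // dim_rV.
have [x xP] := fin_all_exists (fun i => exists_complement_basis (dimHr i)).
(* p ^ l <= p * p ^ l.-1, and p ^ l.-1 < 4tr by minimality of l. *)
have card_le : ((4 * t * (r - 1) + 1) * p ^ minn l r <= 16 * p * t ^ 2 * r ^ 2)%N.
  have -> : (16 * p * t ^ 2 * r ^ 2 = 4 * t * r * (p * (4 * t * r)))%N by lia.
  apply: leq_mul => //; apply: leq_trans (_ : p ^ l <= _)%N.
    by rewrite leq_exp2l // geq_minl.
  by rewrite -(prednK l_gt0) expnS leq_mul2l ltnW ?orbT.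
exists r, (minn l r), H, x; split.
- by split=> //; rewrite leq_min l_gt0 r_ge1 geq_minr.
- exact: leq_trans (card_Gamma1 p_prime dimH) card_le.
have := card_Gamma2 k' x p_prime dimH; rewrite mulnA => card2.
have {card2} : (#|Gamma2 k' H x| <= 16 * p * t ^ 2 * r ^ 3 * (k' + 2))%N.
  apply: leq_trans card2 _.
  have -> : (16 * p * t ^ 2 * r ^ 3 * (k' + 2) =
             16 * p * t ^ 2 * r ^ 2 * ((k' + 2) * r))%N by lia.
  by rewrite leq_mul // leq_mul // leq_subr.
rewrite -(ler_nat R) => /le_trans -> //.
rewrite -!natrX -!natrM [leLHS]natrM ler_wpM2l ?ler0n //.
have ln2 : 0 < ln 2 :> R by rewrite ln_gt0 // ltr1n.
rewrite natrD addrC lerD2l ler_pdivlMr // mulr_natl -lnXn //.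
by rewrite ler_ln ?posrE ?exprn_gt0 ?ltr0n // -natrX ler_nat.
Qed.
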